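(* Let $FB$ and $TC$ be two classes of morphisms in a locally cartesian closed category $\mathcal C$ such that: (i) a morphism is in $FB$ if and only if it has the right lifting property for $TC$; (ii) for all morphisms $f:B'\to B$, $p_1:E_1\to B$, $p_2:E_2\to B$ and $i:E_1\to E_2$ over $B$ (i.e. $i\circ p_2=p_1$) with $p_1,p_2\in FB$ and $i\in TC$, the morphism $Id_{B'}\times i:(B',f)\times_B(E_1,p_1)\to(B',f)\times_B(E_2,p_2)$ is in $TC$. Let $p:\tilde U\to U$ be a universe in $\mathcal C$ and $(Eq,\Omega)$ a J1-structure on $p$ such that $p$ is in $FB$ and $\omega$ is in $TC$. Then there exists an extension of $(Eq,\Omega)$ to a full J-structure on $p$, i.e. there exists a J2-structure $Jp$ on $p$ relative to $(Eq,\Omega)$.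
   Context: Composition is written in diagrammatic order: $f\circ g$ means first $f$, then $g$. Lifting. A morphism $p:E\to B$ has the right lifting property for $TC$ if for every $i:Z\to W$ in $TC$ and all $f_Z:Z\to E$, $f_W:W\to B$ with $f_Z\circ p=i\circ f_W$ there exists $g:W\to E$ with $i\circ g=f_Z$ and $g\circ p=f_W$. Universes. A universe in $\mathcal C$ is a morphism $p:\tilde U\to U$ together with, for every object $X$ and every $F:X\to U$, a chosen pull-back square with vertex $(X;F)$ and projections $p_{X,F}:(X;F)\to X$, $Q(F):(X;F)\to\tilde U$. For $f:W\to X$, $g:W\to\tilde U$ with $f\circ F=g\circ p$, $f*g:W\to(X;F)$ is the unique morphism with $(f*g)\circ p_{X,F}=f$, $(f*g)\circ Q(F)=g$. J0- and J1-structures. A J0-structure on $p$ is a morphism $Eq:(\tilde U;p)\to U$. Put $E\tilde U:=((\tilde U;p);Eq)$ and $p_E:=p_{(\tilde U;p),Eq}\circ p_{\tilde U,p}\circ p:E\tilde U\to U$. A J1-structure over $Eq$ is a morphism $\Omega:\tilde U\to\tilde U$ with $\Omega\circ p=\Delta\circ Eq$, where $\Delta=Id_{\tilde U}*Id_{\tilde U}:\tilde U\to(\tilde U;p)$; the pair $(Eq,\Omega)$ is also called a J1-structure. Put $\omega:=\Delta*\Omega:\tilde U\to E\tilde U$ (a morphism over $U$). Locally cartesian closed categories. Such a category has chosen fiber products $(X,f)\times_Z(Y,g)$, a final object, and chosen relative internal Hom-objects $\underline{Hom}_Z((X,f),(Y,g))$ over $Z$ (right adjoint to fiber product over $Z$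 with $(X,f)$). No compatibility is assumed with the universe structure. Put $I_p(V):=\underline{Hom}_U((\tilde U,p),(U\times V,pr_1))$; for $a:V\to V'$, $I_p(a)$ is induced by $Id_U\times a$; for $h:\tilde U'\to\tilde U$ over $U$, with $p'=h\circ p$, $I^h(V):I_p(V)\to I_{p'}(V)$ is induced by pre-composition with $h$. J2-structures. Let $Fp=(I_{p_E}(U),I^{\omega}(U))\times_{I_p(U)}(I_p(\tilde U),I_p(p))$ and let $coJ:I_{p_E}(\tilde U)\to Fp$ be the morphism with components $I_{p_E}(p)$ and $I^{\omega}(\tilde U)$. A J2-structure on $p$ relative to $(Eq,\Omega)$ is a morphism $Jp:Fp\to I_{p_E}(\tilde U)$ with $Jp\circ coJ=Id_{Fp}$. A (full) J-structure is a triple $(Eq,\Omega,Jp)$. *)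

(* Defs.v *)
Set Implicit Arguments.
Unset Strict Implicit.
Unset Printing Implicit Defensive.

Declare Scope cat_scope.
Delimit Scope cat_scope with cat.
Local Open Scope cat_scope.

Record category := Category {
  ob :> Type;
  hom : ob -> ob -> Type;
  idm : forall X : ob, hom X X;
  comp : forall X Y Z : ob, hom X Y -> hom Y Z -> hom X Z;
  comp_idl : forall (X Y : ob) (f : hom X Y), comp (idm X) f = f;
  comp_idr : forall (X Y : ob) (f : hom X Y), comp f (idm Y) = f;
  comp_assoc : forall (X Y Z W : ob) (f : hom X Y) (g : hom Y Z) (h : hom Z W),
    comp f (comp g h) = comp (comp f g) h
}.
Arguments hom {c} _ _.
Arguments idm {c} X.

(* Diagrammatic order: [f >> g] is first [f], then [g]. *)
Notation "f >> g" := (comp f g) (at level 40, left associativity) : cat_scope.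

Definition morphism_class (C : category) := forall X Y : C, hom X Y -> Prop.

Definition has_rlp (C : category) (TC : morphism_class C) (E B : C)
    (p : hom E B) : Prop :=
  forall (Z W : C) (i : hom Z W), TC Z W i ->
  forall (fZ : hom Z E) (fW : hom W B), fZ >> p = i >> fW ->
  exists g : hom W E, i >> g = fZ /\ g >> p = fW.

(* A chosen pull-back of [f] and [g]: a vertex with its two projections and its
   universal property.  The mediating morphism is recorded as an operation; it
   is determined by [pb_uniq]. *)
Record pullback (C : category) (X Y Z : C) (f : hom X Z) (g : hom Y Z) :=
  Pullback {
  pb_ob :> C;
  pb_fst : hom pb_ob X;
  pb_snd : hom pb_ob Y;
  pb_comm : pb_fst >> f = pb_snd >> g;
  pb_lift : forall (W : C) (a : hom W X) (b : hom W Y),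
    a >> f = b >> g -> hom W pb_ob;
  pb_lift_fst : forall (W : C) (a : hom W X) (b : hom W Y) (e : a >> f = b >> g),
    pb_lift e >> pb_fst = a;
  pb_lift_snd : forall (W : C) (a : hom W X) (b : hom W Y) (e : a >> f = b >> g),
    pb_lift e >> pb_snd = b;
  pb_uniq : forall (W : C) (c c' : hom W pb_ob),
    c >> pb_fst = c' >> pb_fst -> c >> pb_snd = c' >> pb_snd -> c = c'
}.

Definition pb_diag (C : category) (X Y Z : C) (f : hom X Z) (g : hom Y Z)
    (P : pullback f g) : hom P Z := pb_fst P >> f.

Lemma pb_map_comm (C : category) (Z X X' Y Y' : C)
    (f : hom X Z) (f' : hom X' Z) (g : hom Y Z) (g' : hom Y' Z)
    (P : pullback f g) (a : hom X X') (b : hom Y Y')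
    (ea : a >> f' = f) (eb : b >> g' = g) :
  (pb_fst P >> a) >> f' = (pb_snd P >> b) >> g'.
Proof.
  rewrite <- !comp_assoc, ea, eb. apply pb_comm.
Qed.

(* The morphism [a x b] between fiber products over [Z] induced by morphisms
   [a] and [b] over [Z]. *)
Definition pb_map (C : category) (Z X X' Y Y' : C)
    (f : hom X Z) (f' : hom X' Z) (g : hom Y Z) (g' : hom Y' Z)
    (P : pullback f g) (P' : pullback f' g') (a : hom X X') (b : hom Y Y')
    (ea : a >> f' = f) (eb : b >> g' = g) : hom P P' :=
  pb_lift P' (pb_map_comm P ea eb).

Record final_object (C : category) := FinalObject {
  fin_ob :> C;
  fin_to : forall X : C, hom X fin_ob;
  fin_uniq : forall (X : C) (a b : hom X fin_ob), a = b
}.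

(* [Hom_Z((X,f),(Y,g))] as an object [(rh_ob, rh_proj)] over [Z] with a
   universal evaluation morphism over [Z] from its fiber product with [(X,f)];
   [rh_curry] is the transposition of the adjunction with [- x_Z (X,f)]. *)
Record rel_hom (C : category)
    (fp : forall (X Y Z : C) (f : hom X Z) (g : hom Y Z), pullback f g)
    (X Y Z : C) (f : hom X Z) (g : hom Y Z) := RelHom {
  rh_ob :> C;
  rh_proj : hom rh_ob Z;
  rh_ev : hom (fp _ _ _ rh_proj f) Y;
  rh_ev_over : rh_ev >> g = pb_diag (fp _ _ _ rh_proj f);
  rh_curry : forall (W : C) (h : hom W Z) (a : hom (fp _ _ _ h f) Y),
    a >> g = pb_diag (fp _ _ _ h f) -> hom W rh_ob;
  rh_curry_over : forall (W : C) (h : hom W Z) (a : hom (fp _ _ _ h f) Y)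
      (e : a >> g = pb_diag (fp _ _ _ h f)),
    rh_curry e >> rh_proj = h;
  rh_beta : forall (W : C) (h : hom W Z) (a : hom (fp _ _ _ h f) Y)
      (e : a >> g = pb_diag (fp _ _ _ h f)),
    pb_map (fp _ _ _ h f) (fp _ _ _ rh_proj f)
      (rh_curry_over e) (comp_idl f) >> rh_ev = a;
  rh_uniq : forall (W : C) (h : hom W Z) (c c' : hom W rh_ob)
      (e : c >> rh_proj = h) (e' : c' >> rh_proj = h),
    pb_map (fp _ _ _ h f) (fp _ _ _ rh_proj f) e (comp_idl f) >> rh_ev
    = pb_map (fp _ _ _ h f) (fp _ _ _ rh_proj f) e' (comp_idl f) >> rh_ev ->
    c = c'
}.

Record lcc_category := LccCategory {
  lcc_cat :> category;
  fiber : forall (X Y Z : lcc_cat) (f : hom X Z) (g : hom Y Z), pullback f g;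
  final : final_object lcc_cat;
  rhom : forall (X Y Z : lcc_cat) (f : hom X Z) (g : hom Y Z),
    rel_hom fiber f g
}.
Arguments fiber {l X Y Z} f g.
Arguments rhom {l X Y Z} f g.

Section RelHomFunctoriality.
Variable C : lcc_category.

Lemma rh_post_over (X Y Y' Z : C) (f : hom X Z) (g : hom Y Z) (g' : hom Y' Z)
    (b : hom Y Y') (eb : b >> g' = g) :
  (rh_ev (rhom f g) >> b) >> g' = pb_diag (fiber (rh_proj (rhom f g)) f).
Proof.
  rewrite <- comp_assoc, eb. apply rh_ev_over.
Qed.

Definition rh_post (X Y Y' Z : C) (f : hom X Z) (g : hom Y Z) (g' : hom Y' Z)
    (b : hom Y Y') (eb : b >> g' = g) : hom (rhom f g) (rhom f g') :=
  rh_curry (rhom f g') (rh_post_over f eb).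

Lemma rh_pre_over (X X' Y Z : C) (f : hom X Z) (f' : hom X' Z) (g : hom Y Z)
    (h : hom X' X) (eh : h >> f = f') :
  (pb_map (fiber (rh_proj (rhom f g)) f') (fiber (rh_proj (rhom f g)) f)
     (comp_idl _) eh >> rh_ev (rhom f g)) >> g
  = pb_diag (fiber (rh_proj (rhom f g)) f').
Proof.
  rewrite <- comp_assoc, rh_ev_over. unfold pb_diag, pb_map.
  rewrite comp_assoc, pb_lift_fst, comp_idr. reflexivity.
Qed.

Definition rh_pre (X X' Y Z : C) (f : hom X Z) (f' : hom X' Z) (g : hom Y Z)
    (h : hom X' X) (eh : h >> f = f') : hom (rhom f g) (rhom f' g) :=
  rh_curry (rhom f' g) (rh_pre_over g eh).

Lemma rh_beta_any (X Y Z W : C) (f : hom X Z) (g : hom Y Z) (h : hom W Z)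
    (a : hom (fiber h f) Y) (e : a >> g = pb_diag (fiber h f))
    (ec : rh_curry (rhom f g) e >> rh_proj (rhom f g) = h) :
  pb_map (fiber h f) (fiber (rh_proj (rhom f g)) f) ec (comp_idl f)
    >> rh_ev (rhom f g) = a.
Proof.
  rewrite <- (rh_beta (rhom f g) e). f_equal.
  apply pb_uniq; unfold pb_map;
    rewrite ?pb_lift_fst, ?pb_lift_snd; reflexivity.
Qed.

Lemma rh_beta_at (X Y Z W V : C) (f : hom X Z) (g : hom Y Z) (h : hom W Z)
    (a : hom (fiber h f) Y) (e : a >> g = pb_diag (fiber h f))
    (k : hom V W) (l : hom V Z) (el : k >> h = l)
    (ec : (k >> rh_curry (rhom f g) e) >> rh_proj (rhom f g) = l) :
  pb_map (fiber l f) (fiber (rh_proj (rhom f g)) f) ec (comp_idl f)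
    >> rh_ev (rhom f g)
  = pb_map (fiber l f) (fiber h f) el (comp_idl f) >> a.
Proof.
  transitivity (pb_map (fiber l f) (fiber h f) el (comp_idl f) >>
    (pb_map (fiber h f) (fiber (rh_proj (rhom f g)) f)
       (rh_curry_over (rhom f g) e) (comp_idl f) >> rh_ev (rhom f g))).
  2: { rewrite rh_beta_any. reflexivity. }
  rewrite comp_assoc. f_equal. unfold pb_map. apply pb_uniq.
  - rewrite pb_lift_fst, <- comp_assoc, pb_lift_fst, !comp_assoc, pb_lift_fst.
    reflexivity.
  - rewrite pb_lift_snd, <- comp_assoc, pb_lift_snd, comp_assoc, pb_lift_snd.
    symmetry. apply comp_idr.
Qed.

Lemma rh_post_pre (X X' Y Y' Z : C) (f : hom X Z) (f' : hom X' Z)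
    (g : hom Y Z) (g' : hom Y' Z)
    (b : hom Y Y') (eb : b >> g' = g) (h : hom X' X) (eh : h >> f = f') :
  rh_post f eb >> rh_pre g' eh = rh_pre g eh >> rh_post f' eb.
Proof.
  assert (o1 : rh_post f eb >> rh_proj (rhom f g') = rh_proj (rhom f g))
    by apply rh_curry_over.
  assert (o2 : rh_pre g eh >> rh_proj (rhom f' g) = rh_proj (rhom f g))
    by apply rh_curry_over.
  assert (e1 : (rh_post f eb >> rh_pre g' eh) >> rh_proj (rhom f' g')
               = rh_proj (rhom f g)).
  { rewrite <- comp_assoc. unfold rh_pre. rewrite rh_curry_over. exact o1. }
  assert (e2 : (rh_pre g eh >> rh_post f' eb) >> rh_proj (rhom f' g')
               = rh_proj (rhom f g)).
  { rewrite <- comp_assoc. unfold rh_post. rewrite rh_curry_over. exact o2. }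
  apply (rh_uniq (e := e1) (e' := e2)).
  transitivity
    (pb_map (fiber (rh_proj (rhom f g)) f') (fiber (rh_proj (rhom f g')) f') o1
       (comp_idl f')
     >> (pb_map (fiber (rh_proj (rhom f g')) f')
           (fiber (rh_proj (rhom f g')) f) (comp_idl _) eh
         >> rh_ev (rhom f g'))).
  { apply rh_beta_at. }
  transitivity
    (pb_map (fiber (rh_proj (rhom f g)) f') (fiber (rh_proj (rhom f' g)) f') o2
       (comp_idl f') >> (rh_ev (rhom f' g) >> b)).
  2: { symmetry. apply rh_beta_at. }
  transitivity
    (pb_map (fiber (rh_proj (rhom f g)) f') (fiber (rh_proj (rhom f g)) f)
       (comp_idl _) eh >> (rh_ev (rhom f g) >> b)).
  - rewrite <- (rh_beta_any (e := rh_post_over f eb) o1), !comp_assoc.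
    f_equal. unfold pb_map. apply pb_uniq; rewrite <- !comp_assoc.
    + rewrite !pb_lift_fst, !comp_assoc, !pb_lift_fst, !comp_idr. reflexivity.
    + rewrite !pb_lift_snd, !comp_assoc, !pb_lift_snd, !comp_idr. reflexivity.
  - rewrite !comp_assoc, <- (rh_beta_any (e := rh_pre_over g eh) o2).
    reflexivity.
Qed.

(* [U x V] as the fiber product over the final object. *)
Definition bprod (U V : C) : pullback (fin_to (final C) U) (fin_to (final C) V) :=
  fiber _ _.

Definition bprod_map (U V V' : C) (a : hom V V') : hom (bprod U V) (bprod U V') :=
  pb_map (bprod U V) (bprod U V') (fin_uniq (idm U >> fin_to _ U) (fin_to _ U))
    (fin_uniq (a >> fin_to _ V') (fin_to _ V)).

Lemma bprod_map_over (U V V' : C) (a : hom V V') :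
  bprod_map U a >> pb_fst (bprod U V') = pb_fst (bprod U V).
Proof.
  unfold bprod_map, pb_map. rewrite pb_lift_fst. apply comp_idr.
Qed.

(* [I_p(V)] for an arbitrary morphism [p] with codomain [B]; it is used both
   for the universe [p] and for [p_E]. *)
Definition Ip (A B : C) (p : hom A B) (V : C) :
    rel_hom (@fiber C) p (pb_fst (bprod B V)) :=
  rhom p (pb_fst (bprod B V)).

Definition Ip_map (A B : C) (p : hom A B) (V V' : C) (a : hom V V') :
    hom (Ip p V) (Ip p V') :=
  rh_post p (bprod_map_over B a).

Definition Ip_pre (A A' B : C) (p : hom A B) (p' : hom A' B) (h : hom A' A)
    (eh : h >> p = p') (V : C) : hom (Ip p V) (Ip p' V) :=
  rh_pre (pb_fst (bprod B V)) eh.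

Lemma Ip_map_pre (A A' B : C) (p : hom A B) (p' : hom A' B) (h : hom A' A)
    (eh : h >> p = p') (V V' : C) (a : hom V V') :
  Ip_map p a >> Ip_pre eh V' = Ip_pre eh V >> Ip_map p' a.
Proof. apply rh_post_pre. Qed.

End RelHomFunctoriality.

Record universe (C : category) := Universe {
  Ut : C;
  U : C;
  up : hom Ut U;
  upb : forall (X : C) (F : hom X U), pullback F up
}.

Section UniverseOperations.
Variables (C : category) (u : universe C).

(* The vertex [(X;F)], the projections [p_{X,F}] and [Q(F)], and [f * g]. *)
Definition uext (X : C) (F : hom X (U u)) : C := upb F.

Definition uproj (X : C) (F : hom X (U u)) : hom (uext F) X := pb_fst (upb F).

Definition uQ (X : C) (F : hom X (U u)) : hom (uext F) (Ut u) := pb_snd (upb F).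

Definition ustar (W X : C) (F : hom X (U u)) (f : hom W X) (g : hom W (Ut u))
    (e : f >> F = g >> up u) : hom W (uext F) := pb_lift (upb F) e.

Definition Delta : hom (Ut u) (uext (up u)) :=
  @ustar _ _ (up u) (idm (Ut u)) (idm (Ut u)) eq_refl.

Definition J0_structure := hom (uext (up u)) (U u).

Definition EUt (Eq : J0_structure) : C := uext Eq.

Definition pE (Eq : J0_structure) : hom (EUt Eq) (U u) :=
  uproj Eq >> uproj (up u) >> up u.

Record J1_structure := J1Structure {
  J1_Eq : J0_structure;
  J1_Omega : hom (Ut u) (Ut u);
  J1_comm : J1_Omega >> up u = Delta >> J1_Eq
}.

Definition omega (j : J1_structure) : hom (Ut u) (EUt (J1_Eq j)) :=
  ustar (eq_sym (J1_comm j)).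

Lemma omega_over (j : J1_structure) : omega j >> pE (J1_Eq j) = up u.
Proof.
  unfold pE, omega, EUt, Delta, ustar, uproj, uext.
  rewrite !comp_assoc, !pb_lift_fst. apply comp_idl.
Qed.

End UniverseOperations.

Section J2.
Variables (C : lcc_category) (u : universe C).

Definition Fp (j : J1_structure u) :
    pullback (Ip_pre (omega_over j) (U u)) (Ip_map (up u) (up u)) :=
  fiber _ _.

Definition coJ (j : J1_structure u) : hom (Ip (pE (J1_Eq j)) (Ut u)) (Fp j) :=
  pb_lift (Fp j) (Ip_map_pre (omega_over j) (up u)).

Record J2_structure (j : J1_structure u) := J2Structure {
  Jp :> hom (Fp j) (Ip (pE (J1_Eq j)) (Ut u));
  Jp_coJ : Jp >> coJ j = idm (Fp j)
}.

Record J_structure := JStructure {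
  J_J1 :> J1_structure u;
  J_J2 : J2_structure J_J1
}.

End J2.

(* Main.v *)
Require Import Defs.
Set Implicit Arguments.
Unset Strict Implicit.
Unset Printing Implicit Defensive.
Local Open Scope cat_scope.

(** A section of [coJ] is the transpose of a single lift.

    Over the base, a morphism [W -> Hom_Z((X,f),(Y,g))] lying over [h : W -> Z]
    is the same as a morphism [W x_Z X -> Y] over [Z] ([uncurry] below).  Take
    [W := Fp] with its structure map to [U].  Its two projections transpose to
    [Fp x_U EUt -> U x U] and [Fp x_U Ut -> U x Ut], and the equation between
    the projections of the fiber product [Fp] says exactly that these two
    morphisms form a commutative square from [Id x omega] to [Id x p].
    A diagonal filler of this square, transposed back, is a morphism
    [Fp -> I_{p_E}(Ut)]: its two triangles are the two components of
    [Jp >> coJ = Id].  This is [rh_gap_section], stated for an arbitrary map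
    of exponents and an arbitrary map of targets.

    The filler exists because [Id x omega] is in [TC] by stability of [TC]
    under base change, while [Id x p], a base change of [p], inherits the right
    lifting property.  Stability applies to [omega] only once [p_E] is known to
    be in [FB]; as [p_E] is a composite of two base changes of [p] and [p]
    itself, this follows from closure of the right lifting property under
    composition and base change. *)

Section RightLifting.
Variables (C : category) (TC : morphism_class C).

Lemma has_rlp_comp (X Y Z : C) (p : hom X Y) (q : hom Y Z) :
  has_rlp TC p -> has_rlp TC q -> has_rlp TC (p >> q).
Proof.
  intros Hp Hq V W i Hi fV fW e.
  rewrite comp_assoc in e.
  destruct (Hq _ _ i Hi _ _ e) as [g [ig gq]].
  destruct (Hp _ _ i Hi fV g (eq_sym ig)) as [k [ik kp]].
  exists k. split; [exact ik|].
  rewrite comp_assoc, kp. exact gq.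
Qed.

Lemma has_rlp_pb_fst (X Y Z : C) (f : hom X Z) (q : hom Y Z)
    (P : pullback f q) :
  has_rlp TC q -> has_rlp TC (pb_fst P).
Proof.
  intros Hq V W i Hi fV fW e.
  assert (sq : (fV >> pb_snd P) >> q = i >> (fW >> f)).
  { rewrite <- comp_assoc, <- pb_comm, !comp_assoc, e. reflexivity. }
  destruct (Hq _ _ i Hi _ _ sq) as [g [ig gq]].
  exists (pb_lift P (eq_sym gq)). split.
  - apply pb_uniq; rewrite <- comp_assoc.
    + rewrite pb_lift_fst. symmetry. exact e.
    + rewrite pb_lift_snd. exact ig.
  - apply pb_lift_fst.
Qed.

End RightLifting.

Lemma has_rlp_bprod_map (C : lcc_category) (TC : morphism_class C)
    (B V V' : C) (q : hom V V') :
  has_rlp TC q -> has_rlp TC (bprod_map B q).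
Proof.
  intros Hq Z W i Hi fZ fW e.
  assert (map_snd : bprod_map B q >> pb_snd (bprod B V')
                    = pb_snd (bprod B V) >> q) by apply pb_lift_snd.
  assert (sq : (fZ >> pb_snd (bprod B V)) >> q
               = i >> (fW >> pb_snd (bprod B V'))).
  { rewrite <- comp_assoc, <- map_snd, !comp_assoc, e. reflexivity. }
  destruct (Hq _ _ i Hi _ _ sq) as [g [ig gq]].
  exists (pb_lift (bprod B V)
            (fin_uniq ((fW >> pb_fst (bprod B V')) >> fin_to (final C) B)
                      (g >> fin_to (final C) V))).
  split.
  - apply pb_uniq; rewrite <- comp_assoc.
    + rewrite pb_lift_fst, comp_assoc, <- e, <- comp_assoc, bprod_map_over.
      reflexivity.
    + rewrite pb_lift_snd. exact ig.
  - apply pb_uniq; rewrite <- comp_assoc.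
    + rewrite bprod_map_over. apply pb_lift_fst.
    + rewrite map_snd, comp_assoc, pb_lift_snd. exact gq.
Qed.

Lemma has_rlp_pE (C : category) (TC : morphism_class C) (u : universe C)
    (Eq : J0_structure u) :
  has_rlp TC (up u) -> has_rlp TC (pE Eq).
Proof.
  intro Hp. unfold pE, uproj.
  repeat apply has_rlp_comp; try apply has_rlp_pb_fst; exact Hp.
Qed.

Section Uncurry.
Variable C : lcc_category.

(** The structure map [h] of [W] is a parameter, with a proof [e] that [c] lies
    over it, so that two morphisms over provably equal but different composites
    have transposes with the same source. *)
Definition uncurry (X Y Z W : C) (f : hom X Z) (g : hom Y Z) (h : hom W Z)
    (c : hom W (rhom f g)) (e : c >> rh_proj (rhom f g) = h) :
    hom (fiber h f) Y :=
  pb_map (fiber h f) (fiber (rh_proj (rhom f g)) f) e (comp_idl f)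
    >> rh_ev (rhom f g).

Lemma uncurry_over (X Y Z W : C) (f : hom X Z) (g : hom Y Z) (h : hom W Z)
    (c : hom W (rhom f g)) (e : c >> rh_proj (rhom f g) = h) :
  uncurry e >> g = pb_diag (fiber h f).
Proof.
  unfold uncurry. rewrite <- comp_assoc, rh_ev_over. unfold pb_diag, pb_map.
  rewrite comp_assoc, pb_lift_fst, <- comp_assoc, e. reflexivity.
Qed.

Lemma uncurry_post (X Y Y' Z W : C) (f : hom X Z) (g : hom Y Z)
    (g' : hom Y' Z) (b : hom Y Y') (eb : b >> g' = g) (h : hom W Z)
    (c : hom W (rhom f g)) (e : c >> rh_proj (rhom f g) = h)
    (e' : (c >> rh_post f eb) >> rh_proj (rhom f g') = h) :
  uncurry e' = uncurry e >> b.
Proof.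
  unfold uncurry, rh_post.
  rewrite (rh_beta_at (e := rh_post_over f eb) e), comp_assoc. reflexivity.
Qed.

Lemma uncurry_pre (X X' Y Z W : C) (f : hom X Z) (f' : hom X' Z)
    (g : hom Y Z) (i : hom X' X) (ei : i >> f = f') (h : hom W Z)
    (c : hom W (rhom f g)) (e : c >> rh_proj (rhom f g) = h)
    (e' : (c >> rh_pre g ei) >> rh_proj (rhom f' g) = h) :
  uncurry e' = pb_map (fiber h f') (fiber h f) (comp_idl h) ei >> uncurry e.
Proof.
  unfold uncurry, rh_pre.
  rewrite (rh_beta_at (e := rh_pre_over g ei) e), !comp_assoc. f_equal.
  (* Both sides are [c x i]. *)
  unfold pb_map. apply pb_uniq; rewrite <- !comp_assoc.
  - rewrite !pb_lift_fst, !comp_assoc, !pb_lift_fst, !comp_idr. reflexivity.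
  - rewrite !pb_lift_snd, !comp_assoc, !pb_lift_snd, !comp_idr. reflexivity.
Qed.

(** Such an [s] is a section of the comparison map from [Hom_Z(X,Y)] to the
    fiber product of [Hom_Z(X,Y')] and [Hom_Z(X',Y)] over [Hom_Z(X',Y')].
    By transposition it is a diagonal filler of a single square, the universal
    one: from [P x_Z i] to [b].  Giving the two components of the section
    separately keeps the conclusion independent of the proof that the
    comparison map is well defined. *)
Lemma rh_gap_section (TC : morphism_class C) (X X' Y Y' Z : C)
    (f : hom X Z) (f' : hom X' Z) (g : hom Y Z) (g' : hom Y' Z)
    (b : hom Y Y') (eb : b >> g' = g) (i : hom X' X) (ei : i >> f = f')
    (P : pullback (rh_pre g' ei) (rh_post f' eb)) :
  has_rlp TC b ->
  (forall h : hom P Z,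
     TC _ _ (pb_map (fiber h f') (fiber h f) (comp_idl h) ei)) ->
  exists s : hom P (rhom f g),
    s >> rh_post f eb = pb_fst P /\ s >> rh_pre g ei = pb_snd P.
Proof.
  intros Hb Hi.
  pose (h := pb_fst P >> rh_proj (rhom f g')).
  assert (e1 : pb_fst P >> rh_proj (rhom f g') = h) by reflexivity.
  assert (e1' : (pb_fst P >> rh_pre g' ei) >> rh_proj (rhom f' g') = h).
  { rewrite <- comp_assoc. unfold rh_pre. rewrite rh_curry_over. exact e1. }
  assert (e2' : (pb_snd P >> rh_post f' eb) >> rh_proj (rhom f' g') = h).
  { rewrite <- pb_comm. exact e1'. }
  assert (e2 : pb_snd P >> rh_proj (rhom f' g) = h).
  { rewrite <- e2', <- comp_assoc. unfold rh_post. rewrite rh_curry_over.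
    reflexivity. }
  (* The pull-back square of [P], transposed. *)
  assert (sq : uncurry e2 >> b
               = pb_map (fiber h f') (fiber h f) (comp_idl h) ei
                 >> uncurry e1).
  { rewrite <- (uncurry_post e2 e2'), <- (uncurry_pre e1 e1').
    clear - C. revert e1' e2'. rewrite (pb_comm P). intros e1' e2'.
    unfold uncurry. f_equal. apply pb_uniq; unfold pb_map;
      rewrite ?pb_lift_fst, ?pb_lift_snd; reflexivity. }
  destruct (Hb _ _ _ (Hi h) _ _ sq) as [l [il lb]].
  assert (el : l >> g = pb_diag (fiber h f)).
  { transitivity (l >> (b >> g')); [f_equal; exact (eq_sym eb)|].
    rewrite comp_assoc, lb. apply uncurry_over. }
  pose (s := rh_curry (rhom f g) el).
  pose (es := rh_curry_over (rhom f g) el : s >> rh_proj (rhom f g) = h).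
  assert (us : uncurry es = l) by apply rh_beta.
  exists s. split.
  - assert (e3 : (s >> rh_post f eb) >> rh_proj (rhom f g') = h).
    { rewrite <- comp_assoc. unfold rh_post. rewrite rh_curry_over. exact es. }
    apply (rh_uniq (e := e3) (e' := e1)). fold (uncurry e3) (uncurry e1).
    rewrite (uncurry_post es e3), us. exact lb.
  - assert (e3 : (s >> rh_pre g ei) >> rh_proj (rhom f' g) = h).
    { rewrite <- comp_assoc. unfold rh_pre. rewrite rh_curry_over. exact es. }
    apply (rh_uniq (e := e3) (e' := e2)). fold (uncurry e3) (uncurry e2).
    rewrite (uncurry_pre es e3), us. exact il.
Qed.

End Uncurry.

Theorem theorem2p3p2 (C : lcc_category) (FB TC : morphism_class C)
  (FB_iff_rlp : forall (E B : C) (p : hom E B), FB E B p <-> has_rlp TC p)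
  (TC_base_change :
     forall (B B' E1 E2 : C) (f : hom B' B) (p1 : hom E1 B) (p2 : hom E2 B)
       (i : hom E1 E2) (ei : i >> p2 = p1),
     FB E1 B p1 -> FB E2 B p2 -> TC E1 E2 i ->
     TC (fiber f p1) (fiber f p2)
       (pb_map (fiber f p1) (fiber f p2) (comp_idl f) ei))
  (u : universe C) (j : J1_structure u)
  (p_FB : FB (Ut u) (U u) (up u))
  (omega_TC : TC (Ut u) (EUt (J1_Eq j)) (omega j)) :
  exists J : J_structure u, J_J1 J = j.
Proof.
  assert (p_rlp : has_rlp TC (up u)) by (apply FB_iff_rlp; exact p_FB).
  assert (pE_FB : FB _ _ (pE (J1_Eq j)))
    by (apply FB_iff_rlp, has_rlp_pE; exact p_rlp).
  destruct (@rh_gap_section C TC _ _ _ _ _ _ _ _ _ _ (bprod_map_over (U u) (up u))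
              _ (omega_over j) (Fp j)) as [s [s_fst s_snd]].
  - apply has_rlp_bprod_map. exact p_rlp.
  - intro h. apply TC_base_change; assumption.
  - assert (es : s >> coJ j = idm (Fp j)).
    { apply pb_uniq; rewrite <- comp_assoc, comp_idl; unfold coJ.
      - rewrite pb_lift_fst. exact s_fst.
      - rewrite pb_lift_snd. exact s_snd. }
    exists (JStructure (J2Structure es)). reflexivity.
Qed.
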